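(* Every $3$-coloring of the edges of the complete graph $K_n$ contains a monochromatic circuit with at least a fraction $\frac16-o(1)$ of the edges of $K_n$, as $n\to\infty$. That is, for every $\varepsilon>0$ there exists $n_0$ such that for all $n\geq n_0$, every $3$-coloring of the edges of $K_n$ contains a monochromatic circuit of length at least $\left(\frac16-\varepsilon\right)\binom{n}{2}$.
   Context: A $3$-coloring of the edges of $K_n$ is an arbitrary map from $E(K_n)$ to a set of three colors (it need not be proper). A trail is a walk without repeated edges (vertices may repeat), and a circuit is a trail whose first and last vertices coincide. The length of a circuit is its number of edges. A circuit is monochromatic if all of its edges have the same color. *)

(* Defs.v *)
From mathcomp Require Import all_boot all_order all_algebra.
From mathcomp Require Import reals.
Set Implicit Arguments.
Unset Strict Implicit.
Unset Printing Implicit Defensive.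

(* Edges of the complete graph on the vertex set 'I_n: the 2-element subsets. *)
Definition Kedge (n : nat) : Type := {e : {set 'I_n} | #|e| == 2}.

Definition coloring (n k : nat) : Type := Kedge n -> 'I_k.

(* A walk x = v_0, v_1, ..., v_m is given by its first vertex x and the sequence
   p = [:: v_1; ...; v_m]; its length, the number of its edges, is size p. *)
Definition walk (n : nat) (x : 'I_n) (p : seq 'I_n) : bool :=
  path (fun u v => u != v) x p.

Definition walk_edges (n : nat) (x : 'I_n) (p : seq 'I_n) : seq {set 'I_n} :=
  pairmap (fun u v => [set u; v]) x p.

Definition trail (n : nat) (x : 'I_n) (p : seq 'I_n) : bool :=
  walk x p && uniq (walk_edges x p).

Definition circuit (n : nat) (x : 'I_n) (p : seq 'I_n) : bool :=
  trail x p && (last x p == x).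

Definition monochromatic (n k : nat) (c : coloring n k)
    (x : 'I_n) (p : seq 'I_n) : Prop :=
  exists a : 'I_k, forall e : Kedge n, val e \in walk_edges x p -> c e = a.

(* Main.v *)
Require Import Defs.
From mathcomp Require Import all_boot all_order all_algebra.
From mathcomp Require Import reals.
From mathcomp Require Import zify lra.
Set Implicit Arguments.
Unset Strict Implicit.
Unset Printing Implicit Defensive.

(* Removing cycles from a colour class and merging those that meet, we cover all
   but [n] of its edges by vertex-disjoint closed trails.  Label each vertex, in
   each colour, by the trail through it: apart from [O(n)] pairs, any two
   vertices agree in one of the three labels, along an edge of their common
   trail.  Write [m] for the largest number of pairs covered by one trail and
   suppose [m <= n^2 / 6].  A class [C] carries at most
   [min (m, |C|^2) <= 0.41 n |C|] pairs.  Up to [o(n)] vertices, one of the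
   following holds:
   - some class contains all vertices; then the pairs number at most
     [m + 2 * 0.41 n^2 < n^2];
   - there is a class of each colour such that every vertex lies in at least two
     of them; the complements being disjoint, the pairs number at most
     [3 m + 0.41 n^2 < n^2];
   - each colour has only two classes, whence [n^2 <= 6 m + o(n^2)]. *)

(** * Three labellings in which most pairs agree *)

Section Structure.
Variables (V : finType) (U : {set V}) (Delta : nat).

Definition disagree (T1 T2 T3 : eqType) (a : V -> T1) (b : V -> T2)
    (c : V -> T3) (u : V) : {set V} :=
  [set w in U | [&& a u != a w, b u != b w & c u != c w]].

Definition one_class (T : eqType) (s : nat) (a : V -> T) : Prop :=
  exists x, #|[set u in U | a u != x]| <= s.

(** The exceptional vertices are those that miss at least two of the three classes. *)
Definition three_classes (T1 T2 T3 : eqType) (s : nat) (a : V -> T1)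
    (b : V -> T2) (c : V -> T3) : Prop :=
  exists x y z, #|[set u in U | [|| (a u != x) && (b u != y),
    (a u != x) && (c u != z) | (b u != y) && (c u != z)]]| <= s.

Definition two_classes (T : eqType) (s : nat) (a : V -> T) : Prop :=
  exists x x', #|[set u in U | (a u != x) && (a u != x')]| <= s.

Lemma card_subU (s t : nat) (X A B : {set V}) :
  X \subset A :|: B -> #|A| <= s -> #|B| <= t -> #|X| <= s + t.
Proof.
move=> /subset_leq_card XAB As Bt; apply: leq_trans XAB _.
by rewrite (leq_trans (leq_card_setU _ _)) // leq_add.
Qed.

Lemma card_sub (s : nat) (X A : {set V}) :
  X \subset A -> #|A| <= s -> #|X| <= s.
Proof. by move=> /subset_leq_card /leq_trans; apply. Qed.

Local Ltac eqcases :=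
  repeat (match goal with
    | |- context [?x == ?y] => case: (@eqP _ x y) => ? //=
    end); try congruence.

(* Vertices off [b^-1 y] and vertices off [c^-1 z] can only agree through [a]. *)
Lemma cross_structure (T1 T2 T3 : eqType) (a : V -> T1) (b : V -> T2)
    (c : V -> T3) (y : T2) (z : T3) (s : nat) :
  (forall u, u \in U -> #|disagree a b c u| <= Delta) ->
  #|[set u in U | (b u != y) && (c u != z)]| <= s ->
  [\/ one_class (s + Delta) b, one_class (s + Delta) c
    | three_classes (s + Delta + Delta) a b c].
Proof.
move=> dis hs.
(* Suppose that [u] has only the label [z], that [v] has only [y], and that [a] joins them. Then a
   vertex with label [y] or [z] that agrees with both has two of the three labels. If no such pair
   exists, a single such [u] forces [c] to be [z] almost everywhere, and without one [b] is [y]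
   almost everywhere. *)
case: (pickP (fun xy : V * V =>
    [&& xy.1 \in U, xy.2 \in U, a xy.1 == a xy.2,
        (b xy.1 != y) && (c xy.1 == z) & (c xy.2 != z) && (b xy.2 == y)]))
  => [[u v] /= /and5P[uU vU /eqP auv /andP[bu /eqP cu] /andP[cv /eqP bv]]|noP].
- apply: Or33; exists (a u), y, z.
  apply: (card_subU (A := [set w in U | (b w != y) && (c w != z)] :|: disagree a b c u)
            (B := disagree a b c v)) (dis _ vU).
  + apply/subsetP=> w; rewrite !inE.
    case: (w \in U) => //=; rewrite cu bv -auv; move: bu cv; eqcases.
  + exact: card_subU (subxx _) hs (dis _ uU).
case: (pickP (fun u => [&& u \in U, b u != y & c u == z])) => [u|noR].
- case/and3P=> uU bu cu; apply: Or32; exists z.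
  apply: card_subU hs (dis _ uU).
  apply/subsetP=> w; rewrite !inE.
  case wU: (w \in U) => //=; have /= := noP (u, w); rewrite uU wU bu cu.
  by move: bu cu; eqcases.
- apply: Or31; exists y; apply: leq_trans (leq_addr _ _); apply: card_sub hs.
  apply/subsetP=> w; rewrite !inE; have := noR w.
  by case: (w \in U) => //=; eqcases.
Qed.

(** Place the vertices of one [a]-class in the grid of pairs of a [b]-label and a [c]-label. If any
    two share a coordinate, the class lies on one line of the grid and [cross_structure] applies. If
    [p] and [q] share none, almost all vertices outside the class sit at the other two corners of
    their rectangle, and the cases depend on which corners are occupied. *)
Lemma label_structure (T1 T2 T3 : eqType) (a : V -> T1) (b : V -> T2)
    (c : V -> T3) (u0 : V) :
  u0 \in U ->
  (forall u, u \in U -> #|disagree a b c u| <= Delta) ->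
  let s := 6 * Delta in
  [\/ [\/ one_class s a, one_class s b | one_class s c],
      three_classes s a b c
    | [/\ two_classes s a, two_classes s b & two_classes s c]].
Proof.
move=> u0U dis s.
have s2 : Delta + Delta <= s by rewrite /s; lia.
have s3 : Delta + Delta + Delta <= s by rewrite /s; lia.
have s4 : (Delta + Delta) + (Delta + Delta) <= s by rewrite /s; lia.
have s5 : Delta + Delta + Delta + Delta + Delta <= s by rewrite /s; lia.
have mono1 (T : eqType) (f : V -> T) t : t <= s -> one_class t f -> one_class s f.
  by move=> ts [x h]; exists x; apply: leq_trans ts.
have mono3 t : t <= s -> three_classes t a b c -> three_classes s a b c.
  by move=> ts [x [y [z h]]]; exists x, y, z; apply: leq_trans ts.
have cross y z t : t + Delta + Delta <= s ->
    #|[set u in U | (b u != y) && (c u != z)]| <= t ->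
    [\/ [\/ one_class s a, one_class s b | one_class s c],
        three_classes s a b c
      | [/\ two_classes s a, two_classes s b & two_classes s c]].
  move=> ts h; case: (cross_structure dis h) => H.
  - by apply: Or31; apply: Or32; apply: mono1 H; apply: leq_trans ts; rewrite leq_addr.
  - by apply: Or31; apply: Or33; apply: mono1 H; apply: leq_trans ts; rewrite leq_addr.
  - by apply: Or32; apply: mono3 H.
pose A u := (u \in U) && (a u == a u0).
have A0 : A u0 by rewrite /A u0U eqxx.
case: (pickP (fun pq : V * V => [&& A pq.1, A pq.2, b pq.1 != b pq.2 & c pq.1 != c pq.2]))
   => [[p q] /= /and4P[/andP[pU /eqP ap] /andP[qU /eqP aq] bpq cpq]|line]; last first.
  have [bAll|] := boolP [forall u, A u ==> (b u == b u0)].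
    apply: (cross (b u0) (c u0) Delta s3).
    apply: card_sub (dis _ u0U); apply/subsetP=> w; rewrite !inE.
    have := forallP bAll w; rewrite /A; case: (w \in U) => //=; eqcases.
  rewrite negb_forall => /existsP[u1]; rewrite negb_imply => /andP[A1 bu1].
  have cA w : A w -> c w = c u0.
    move=> Aw; have := line (u0, u1); have := line (w, u0); have := line (w, u1).
    by rewrite /= Aw A0 A1 /=; move: bu1; eqcases.
  apply: (cross (b u0) (c u0) Delta s3).
  apply: card_sub (dis _ u0U); apply/subsetP=> w; rewrite !inE.
  by have := cA w; rewrite /A; case: (w \in U) => //=; eqcases; move=> H; have := H isT.
(* A vertex outside the class of [u0] that agrees with both [p] and [q] has
   the [b]-label of one and the [c]-label of the other. *)
pose corner y z w := [&& w \in U, a w != a u0, b w == y & c w == z].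
have side : #|[set w in U | [&& a w != a u0, ~~ corner (b p) (c q) w
                            & ~~ corner (b q) (c p) w]]| <= Delta + Delta.
  apply: card_subU (dis _ pU) (dis _ qU); apply/subsetP=> w; rewrite !inE /corner ap aq.
  by case: (w \in U) => //=; move: bpq cpq; eqcases.
case: (pickP (corner (b p) (c q))) => [u Cu|no1];
  case: (pickP (corner (b q) (c p))) => [v Cv|no2]; last first.
- apply: Or31; apply: Or31; exists (a u0).
  apply: leq_trans s2.
  by apply: card_sub side; apply/subsetP=> w; rewrite !inE no1 no2 /= andbT.
- case/and4P: (Cv) => vU av /eqP bv /eqP cv.
  apply: (cross (b q) (c p) (Delta + Delta + Delta) s5).
  apply: card_subU side (dis _ vU); apply/subsetP=> w; rewrite !inE no1 /corner bv cv.
  by case: (w \in U) => //=; move: av; eqcases.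
- case/and4P: (Cu) => uU au /eqP bu /eqP cu.
  apply: (cross (b p) (c q) (Delta + Delta + Delta) s5).
  apply: card_subU side (dis _ uU); apply/subsetP=> w; rewrite !inE no2 /corner bu cu.
  by case: (w \in U) => //=; move: au; eqcases.
(* Vertices at opposite corners differ in [b] and in [c]. If no [a]-class meets both corners, each
   corner has at most [Delta] vertices and the class of [u0] is almost everything. Otherwise [x] and
   [y] confine every label to two values. *)
case: (pickP (fun xy : V * V => [&& corner (b p) (c q) xy.1,
    corner (b q) (c p) xy.2 & a xy.1 == a xy.2])) => [[x y]|noA]; last first.
  apply: Or31; apply: Or31; exists (a u0).
  apply: leq_trans s4.
  case/and4P: (Cu) => uU au /eqP bu /eqP cu.
  case/and4P: (Cv) => vU av /eqP bv /eqP cv.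
  apply: (card_subU (B := disagree a b c u :|: disagree a b c v)) side _; last first.
    exact: card_subU (subxx _) (dis _ uU) (dis _ vU).
  apply/subsetP=> w; have := noA (u, w); have := noA (w, v).
  rewrite /= Cu Cv !inE /corner bu cu bv cv.
  by case: (w \in U) => //=; move: bpq cpq; eqcases.
case/and3P=> /= /and4P[xU ax /eqP bx /eqP cx] /and4P[yU ay /eqP yb /eqP yc] /eqP axy.
have key : #|[set w in U | [|| (a w != a u0) && (a w != a x),
    (b w != b p) && (b w != b q) | (c w != c p) && (c w != c q)]]| <= s.
  apply: leq_trans s4.
  apply: (card_subU (B := disagree a b c x :|: disagree a b c y)) side _; last first.
    exact: card_subU (subxx _) (dis _ xU) (dis _ yU).
  apply/subsetP=> w; rewrite !inE /corner bx cx yb yc -axy.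
  by case: (w \in U) => //=; move: bpq cpq ax; eqcases.
apply: Or33; split; [exists (a u0), (a x)|exists (b p), (b q)|exists (c p), (c q)];
  apply: card_sub key; apply/subsetP=> w; rewrite !inE => /andP[-> ->];
  by rewrite ?orbT.
Qed.

End Structure.

(** * Counting pairs inside classes *)

(** Pairs are ordered, so for a symmetric [D] without loops every edge counts twice. *)
Definition mass (V T : finType) (D : rel V) (lab : V -> T) (P : pred T) : nat :=
  \sum_(u | P (lab u)) #|[set v | D u v]|.

Lemma sum3E (F : 'I_3 -> nat) :
  \sum_i F i = F ord0 + F (@Ordinal 3 1 isT) + F (@Ordinal 3 2 isT).
Proof.
rewrite !big_ord_recl big_ord0 addn0 addnA.
by congr (_ + F _ + F _); apply: val_inj.
Qed.

Section Mass.
Variables (V T : finType) (D : rel V) (lab : V -> T).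

Lemma mass_union (P Q R : pred T) :
  (forall x, P x -> Q x || R x) -> mass D lab P <= mass D lab Q + mass D lab R.
Proof.
move=> PQR; rewrite /mass big_mkcond [X in _ <= X + _]big_mkcond.
rewrite [X in _ <= _ + X]big_mkcond -big_split; apply: leq_sum => u _ /=.
have := PQR (lab u); case: (P _) => //=.
by case: (Q _) => //= [_|->//]; rewrite leq_addr.
Qed.

Lemma mass_le (P : pred T) : mass D lab P <= #|V| * #|[set u | P (lab u)]|.
Proof.
rewrite mulnC -sum_nat_const; under [X in _ <= X]eq_bigl do rewrite inE.
by apply: leq_sum => u _; apply: max_card.
Qed.

Hypothesis Dlab : forall u v, D u v -> lab u = lab v.

Lemma mass_class_le x : mass D lab (pred1 x) <= #|[set u | lab u == x]| ^ 2.
Proof.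
rewrite -mulnn -sum_nat_const; under [X in _ <= X]eq_bigl do rewrite inE.
apply: leq_sum => u /eqP ux; apply: subset_leq_card; apply/subsetP=> v.
by rewrite !inE => /Dlab <-; rewrite ux.
Qed.

(* Since [min (t, x ^ 2) <= sqrt t * x], and [1 / 6 < 0.41 ^ 2]. *)
Lemma mass_linear (P : pred T) :
  (forall x, 6 * mass D lab (pred1 x) <= #|V| ^ 2) ->
  100 * mass D lab P <= 41 * (#|V| * #|[set u | P (lab u)]|).
Proof.
move=> small.
have partM : mass D lab P = \sum_(x | P x) mass D lab (pred1 x).
  rewrite /mass (partition_big lab P) //=; apply: eq_bigr => x Px.
  by apply: eq_bigl => u; case: eqP => [->|]; rewrite ?Px ?andbF.
have partC : #|[set u | P (lab u)]| = \sum_(x | P x) #|[set u | lab u == x]|.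
  rewrite -sum1_card; under eq_bigl do rewrite inE.
  rewrite (partition_big lab P) //=; apply: eq_bigr => x Px.
  rewrite -sum1_card; apply: eq_bigl => u.
  by rewrite inE; case: eqP => [->|]; rewrite ?Px ?andbF.
rewrite partM partC !big_distrr /=; apply: leq_sum => x _.
have := small x; have := mass_class_le x.
move: (mass _ _ _) (#|[set u | _]|) #|V| => e k n.
(* Small classes use [e <= k ^ 2], large ones [6 * e <= n ^ 2]. *)
case: (leqP (100 * k) (41 * n)) => h h1 h2; first by nia.
have : 41 * n * (41 * n) <= 41 * n * (100 * k) by rewrite leq_mul2l (ltnW h) orbT.
nia.
Qed.

End Mass.

(** Here [d] measures how far every class stays below [n ^ 2 / 6] pairs, and [z] bounds the vertices
    that escape the structure of the labels. The bound on [z] keeps the errors below the smallest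
    gap of the first two cases, [1 - 1/6 - 0.82 = 1/75]; the bound on [d] serves the case of two
    classes per colour. *)
Lemma light_classes_absurd (V T : finType) (D : 'I_3 -> rel V) (lab : 'I_3 -> V -> T)
    (Delta d : nat) :
  let bad u := [set v | ~~ [exists i, D i u v]] in
  let U := [set u | #|bad u| <= Delta] in
  let z := #|~: U| + 6 * Delta in
  let n := #|V| in
  (forall i u v, D i u v -> lab i u = lab i v) ->
  \sum_u #|bad u| <= 7 * n ->
  0 < n -> 150 * (z + 7) <= n -> 3 * (z * n) + 7 * n < d ->
  (forall i x, 6 * mass (D i) (lab i) (pred1 x) + d <= n ^ 2) -> False.
Proof.
move=> bad U z n Dlab badle n0 zn dn small.
pose i0 : 'I_3 := ord0; pose i1 := @Ordinal 3 1 isT; pose i2 := @Ordinal 3 2 isT.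
have small' i x : 6 * mass (D i) (lab i) (pred1 x) <= n ^ 2.
  by apply: leq_trans (small i x); rewrite leq_addr.
have total : n ^ 2 <= 7 * n + \sum_i mass (D i) (lab i) predT.
  apply: leq_trans (_ : \sum_u #|bad u| + \sum_i mass (D i) (lab i) predT <= _);
    last by rewrite leq_add2r.
  rewrite /mass exchange_big -big_split /= -mulnn -sum_nat_const.
  apply: leq_sum => u _.
  rewrite /n -cardsT -(cardsID (bad u) [set: V]) setTI leq_add2l.
  apply: leq_trans (_ : #|\bigcup_i [set v | D i u v]| <= _).
    apply: subset_leq_card; apply/subsetP=> v; rewrite !inE andbT negbK.
    by case/existsP=> i iv; apply/bigcupP; exists i; rewrite ?inE.
  elim/big_rec2: _ => [|i k A _ h]; first by rewrite cards0.
  by rewrite (leq_trans (leq_card_setU _ _)) // leq_add2l.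
have disU u : u \in U -> #|disagree U (lab i0) (lab i1) (lab i2) u| <= Delta.
  rewrite inE => uU; apply: leq_trans uU; apply: subset_leq_card.
  apply/subsetP=> w; rewrite inE => /andP[_ /and3P[w0 w1 w2]]; rewrite inE.
  apply/existsP=> -[i /Dlab /eqP iw].
  by case: i iw => [[|[|[|]]]] // lt iw; [case/negP: w0|case/negP: w1|case/negP: w2];
    apply: etrans iw; congr (lab _ _ == lab _ _); apply: val_inj.
have [u0 u0U] : exists u0, u0 \in U.
  apply/set0Pn; rewrite -cards_eq0; apply/eqP=> U0.
  by have := cardsC U; rewrite U0 -/n; lia.
have ext (P : pred V) : #|[set u in U | P u]| <= 6 * Delta -> #|[set u | P u]| <= z.
  move=> h; rewrite -(cardsID (~: U)) leq_add //.
    by apply: subset_leq_card; rewrite subsetIr.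
  by apply: leq_trans h; apply: subset_leq_card; apply/subsetP=> u;
    rewrite !inE negbK andbC.
have lin i P : 100 * mass (D i) (lab i) P <= 41 * (n * #|[set u | P (lab i u)]|).
  by apply: mass_linear => //; apply: Dlab.
have lin1 i : 100 * mass (D i) (lab i) predT <= 41 * (n * n).
  by apply: leq_trans (lin i _) _; rewrite !leq_mul // max_card.
(* [1 / 6 + 2 * 0.41 < 1] *)
have one i : one_class U (6 * Delta) (lab i) -> False.
  case=> x /ext h.
  have mi : mass (D i) (lab i) predT <= mass (D i) (lab i) (pred1 x) + n * z.
    apply: leq_trans (_ : mass (D i) (lab i) (pred1 x)
      + mass (D i) (lab i) (predC1 x) <= _).
      by apply: mass_union => y _ /=; case: eqP.
    rewrite leq_add2l (leq_trans (mass_le _ _ _)) // leq_mul2l.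
    by rewrite h orbT.
  move: total; rewrite (bigD1 i) //=.
  have : 100 * (\sum_(j < 3 | j != i) mass (D j) (lab j) predT) <= 82 * (n * n).
    rewrite big_distrr /=.
    apply: leq_trans (_ : \sum_(j < 3 | j != i) 41 * (n * n) <= _).
      by apply: leq_sum => j _; apply: lin1.
    by rewrite sum_nat_const cardC1 card_ord; lia.
  move: (\sum_(_ | _) _) (small' i x) mi => S.
  move: (mass _ _ _) (mass _ _ _) zn => e f zn.
  have : 150 * ((z + 7) * n) <= n * n by rewrite mulnA leq_mul2r zn orbT.
  rewrite -!mulnn; nia.
case: (label_structure u0U disU) => [[]|[x [y [w /ext h]]]|[[x [x' /ext hx]]
  [y [y' /ext hy]] [w [w' /ext hw]]]]; try exact: one.
- (* [3 / 6 + 0.41 < 1], as the complements of the classes are almost disjoint. *)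
  have mi i x0 : 100 * mass (D i) (lab i) predT <=
      100 * mass (D i) (lab i) (pred1 x0) + 41 * (n * #|[set u | lab i u != x0]|).
    apply: leq_trans (_ : 100 * (mass (D i) (lab i) (pred1 x0) +
      mass (D i) (lab i) (predC1 x0)) <= _).
      by rewrite leq_mul2l /=; apply: mass_union => y0 _ /=; case: eqP.
    by rewrite mulnDr leq_add2l; apply: lin.
  (* Pointwise, a vertex misses at most one of the three classes unless it is exceptional, and then
     at most [3 = 1 + 2]. *)
  have cards : #|[set u | lab i0 u != x]| + #|[set u | lab i1 u != y]|
      + #|[set u | lab i2 u != w]| <= n + 2 * z.
    apply: leq_trans (_ : n + 2 * #|[set u | [|| (lab i0 u != x) && (lab i1 u != y),
      (lab i0 u != x) && (lab i2 u != w) | (lab i1 u != y) && (lab i2 u != w)]]| <= _);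
      last by rewrite leq_add2l leq_mul2l.
    rewrite /n -!sum1_card; under eq_bigl do rewrite inE.
    rewrite big_mkcond; under [X in _ + X + _ <= _]eq_bigl do rewrite inE.
    rewrite [X in _ + X + _ <= _]big_mkcond.
    under [X in _ + _ + X <= _]eq_bigl do rewrite inE.
    rewrite [X in _ + _ + X <= _]big_mkcond.
    under [X in _ <= _ + _ * X]eq_bigl do rewrite inE.
    rewrite [X in _ <= _ + _ * X]big_mkcond big_distrr -!big_split /=.
    by apply: leq_sum => u _; do 3 case: eqP.
  move: total; rewrite sum3E -/i0 -/i1 -/i2.
  move: (mi i0 x) (mi i1 y) (mi i2 w) (small' i0 x) (small' i1 y) (small' i2 w).
  move: (mass (D i0) _ _) (mass (D i1) _ _) (mass (D i2) _ _)
    (mass (D i0) _ _) (mass (D i1) _ _) (mass (D i2) _ _) => m0 m1 m2 e0 e1 e2.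
  move: cards; move: (#|_|) (#|_|) (#|_|) => c0 c1 c2 cards.
  have : n * (c2 + c1 + c0) <= n * (n + 2 * z) by rewrite leq_mul2l cards orbT.
  have : 150 * ((z + 7) * n) <= n * n by rewrite mulnA leq_mul2r zn orbT.
  have : 0 < n * n by rewrite muln_gt0 n0.
  rewrite -!mulnn !mulnDr !mulnDl; nia.
(* Six classes hold at most [n ^ 2 - d] pairs together, and the errors [3 * (z * n) + 7 * n] are
   less than [d]. *)
have mi i x0 x1 : #|[set u | (lab i u != x0) && (lab i u != x1)]| <= z ->
    mass (D i) (lab i) predT <= mass (D i) (lab i) (pred1 x0)
      + mass (D i) (lab i) (pred1 x1) + z * n.
  move=> hz.
  apply: leq_trans (_ : mass (D i) (lab i) (predU (pred1 x0) (pred1 x1)) +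
      mass (D i) (lab i) (predC (predU (pred1 x0) (pred1 x1))) <= _).
    by apply: mass_union => y0 _; apply: orbN.
  apply: leq_add; first by apply: mass_union => y0.
  apply: leq_trans (mass_le _ _ _) _; rewrite mulnC leq_mul2r; apply/orP; right.
  apply: leq_trans hz; apply: subset_leq_card; apply/subsetP=> u.
  by rewrite !inE /= negb_or.
have := small i0 x; have := small i0 x'; have := small i1 y; have := small i1 y'.
have := small i2 w; have := small i2 w'.
move: total; rewrite sum3E -/i0 -/i1 -/i2.
move: (mi i0 _ _ hx) (mi i1 _ _ hy) (mi i2 _ _ hw).
move: (mass (D i0) _ _) (mass (D i1) _ _) (mass (D i2) _ _) => m0 m1 m2.
move: (mass _ _ _) (mass _ _ _) (mass _ _ _) (mass _ _ _) (mass _ _ _) (mass _ _ _).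
move: dn; move: (z * n) (n ^ 2) => zn' n2; lia.
Qed.

(** * Covering a graph by disjoint closed trails *)

Section Circuits.
Variable n : nat.
Implicit Types (x y z : 'I_n) (p q : seq 'I_n) (E : {set {set 'I_n}}).
Implicit Types (t : 'I_n * seq 'I_n) (s : seq ('I_n * seq 'I_n)).

(** Edges may repeat here: their distinctness is carried by separate [uniq] conditions, since it is
    inherited through permutations of edge lists. *)
Definition closed_walk t : bool := walk t.1 t.2 && (last t.1 t.2 == t.1).
Definition cedges t := walk_edges t.1 t.2.
Definition cverts t : seq 'I_n := t.1 :: t.2.

Lemma walk_edges_cat x p q :
  walk_edges x (p ++ q) = walk_edges x p ++ walk_edges (last x p) q.
Proof. exact: pairmap_cat. Qed.

Lemma mem_walk_edges x p (e : {set 'I_n}) w :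
  e \in walk_edges x p -> w \in e -> w \in x :: p.
Proof.
elim: p x => //= y p IH x; rewrite inE => /orP[/eqP->|/IH h /h].
  by rewrite !inE => /orP[]->; rewrite ?orbT.
by rewrite !inE => ->; rewrite orbT.
Qed.

Lemma uniq_walk_edges x p : uniq (x :: p) -> uniq (walk_edges x p).
Proof.
elim: p x => //= y p IH x /andP[xp /IH ->]; rewrite andbT.
by apply: contra xp => /mem_walk_edges; apply; rewrite !inE eqxx.
Qed.

(** Cutting the walk at an occurrence of [z] and exchanging the two pieces moves the base point to
    [z]. *)
Lemma closed_walk_rotate t z : closed_walk t -> z \in cverts t ->
  exists p, [/\ closed_walk (z, p), perm_eq (walk_edges z p) (cedges t)
    & z :: p =i cverts t].
Proof.
case: t => x p /andP[/= wp /eqP lp]; rewrite /cverts /= inE => /orP[/eqP->|].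
  by exists p; split=> //; rewrite /closed_walk /= wp lp eqxx.
move=> zp; case/path.splitP: zp wp lp => p1 p2; exists (p2 ++ rcons p1 z).
move: wp lp; rewrite /walk cat_path last_cat last_rcons => /andP[wp1 wp2] lp.
split.
- by rewrite /closed_walk /walk /= cat_path last_cat last_rcons lp wp1 wp2 /=.
- by rewrite /cedges /= !walk_edges_cat lp last_rcons perm_catC.
- move=> w; have x2 : x \in z :: p2 by rewrite -lp mem_last.
  rewrite !inE !mem_cat mem_rcons inE; case: (w =P x) => [->|_] /=; last first.
    by case: (w == z); case: (w \in p1); case: (w \in p2).
  by move: x2; rewrite inE => /orP[]->; rewrite ?orbT.
Qed.

(** Both walks are rotated to start at the common vertex and then concatenated. *)
Lemma splice t1 t2 z : closed_walk t1 -> closed_walk t2 ->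
  z \in cverts t1 -> z \in cverts t2 ->
  exists t, [/\ closed_walk t, perm_eq (cedges t) (cedges t1 ++ cedges t2)
    & cverts t =i cverts t1 ++ cverts t2].
Proof.
move=> c1 c2 z1 z2.
have [p1 [/andP[/= w1 /eqP l1] e1 v1]] := closed_walk_rotate c1 z1.
have [p2 [/andP[/= w2 l2] e2 v2]] := closed_walk_rotate c2 z2.
exists (z, p1 ++ p2); split.
- by rewrite /closed_walk /walk /= cat_path last_cat l1 l2 andbT; apply/andP.
- by rewrite /cedges /= walk_edges_cat l1 perm_cat.
- move=> w; change ((w \in cverts (z, p1 ++ p2)) = (w \in cverts t1 ++ cverts t2)).
  rewrite mem_cat -v1 -v2 /cverts /= !inE mem_cat.
  by case: (w == z).
Qed.

Definition vdisjoint t t' : bool := ~~ has (mem (cverts t)) (cverts t').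

Definition edges_of s : seq {set 'I_n} := flatten (map cedges s).
Definition verts_of s : seq 'I_n := flatten (map cverts s).

Definition circuit_family s : bool := all closed_walk s && pairwise vdisjoint s.

(** Each member of [s] that meets the growing walk is spliced into it; the others stay. The bound on
    vertices ensures that a member left in place remains disjoint from the result of the later
    merges. *)
Lemma merge_circuit t s : closed_walk t -> circuit_family s ->
  exists s', [/\ circuit_family s', perm_eq (edges_of s') (cedges t ++ edges_of s)
    & {subset verts_of s' <= cverts t ++ verts_of s}].
Proof.
elim: s t => [|t0 s IH] t ct.
  by move=> _; exists [:: t]; rewrite /circuit_family /= ct; split.
rewrite /circuit_family /= => /andP[/andP[ct0 cs] /andP[d0 ds]].
have fs : circuit_family s by rewrite /circuit_family cs.
have [/hasP[z z0 zt]|disj] := boolP (has (mem (cverts t)) (cverts t0)).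
  have [t' [ct' et' vt']] := splice ct ct0 zt z0.
  have [s' [fs' es' vs']] := IH _ ct' fs; exists s'; split=> //.
    apply: perm_trans es' _; rewrite /edges_of /= catA perm_cat2r; exact: et'.
  move=> w /vs'; rewrite !mem_cat vt' mem_cat.
  move=> h; change (w \in cverts t ++ (cverts t0 ++ verts_of s)).
  by rewrite !mem_cat orbA.
have [s' [/andP[cs' ds'] es' vs']] := IH _ ct fs; exists (t0 :: s'); split.
- rewrite /circuit_family /= ct0 cs' ds' /= ?andbT.
  apply/allP=> t' t's; apply/hasPn=> w wt'.
  have : w \in verts_of s' by apply/flattenP; exists (cverts t') => //; apply: map_f.
  move=> /vs'; rewrite mem_cat => /orP[wt|].
    by apply/negP=> w0; case/negP: disj; apply/hasP; exists w.
  case/flattenP => _ /mapP[t1 t1s ->] wt1.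
  by have /hasPn := allP d0 _ t1s; apply.
- rewrite /edges_of /= perm_sym perm_catCA perm_cat2l perm_sym; exact: es'.
- move=> w; change (w \in cverts t0 ++ verts_of s' ->
    w \in cverts t ++ (cverts t0 ++ verts_of s)).
  rewrite !mem_cat => /orP[->|/vs']; rewrite ?orbT //.
  by rewrite mem_cat => /orP[]->; rewrite ?orbT.
Qed.

(** A path is extended at its front by a neighbour other than the preceding vertex. It cannot reach
    [n + 1] distinct vertices, so some extension hits the path and closes a cycle. *)
Lemma cycle_min_degree (W : {set 'I_n}) E x0 :
  x0 \in W -> {in E, forall e : {set 'I_n}, #|e| = 2 /\ e \subset W} ->
  {in W, forall v, 1 < #|[set e in E | v \in e]|} ->
  exists t, [/\ closed_walk t, 0 < size t.2, uniq (cedges t) & {subset cedges t <= E}].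
Proof.
move=> x0W hE deg.
pose e u v := [set u; v] \in E.
have e_neq u v : e u v -> u != v.
  by move=> /hE[]; rewrite cards2; case: (u != v).
have nbr x h : x \in W -> exists y, [/\ e x y, y != h & y \in W].
  move=> /deg /card_gt1P[e1 [e2 [+ + e12]]].
  rewrite !inE => /andP[e1E xe1] /andP[e2E xe2].
  have other e' : e' \in E -> x \in e' -> exists2 y, e' = [set x; y] & y \in W.
    move=> e'E xe'; have [c2 /subsetP sW] := hE _ e'E.
    have : 0 < #|e' :\ x| by move: c2; rewrite (cardsD1 x) xe' add1n => -[->].
    case/card_gt0P=> y /setD1P[yx ye']; exists y; last exact: sW.
    apply/eqP; rewrite eq_sym eqEcard cards2 eq_sym yx c2 leqnn andbT.
    by apply/subsetP=> w; rewrite !inE => /orP[]/eqP->.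
  have [y1 E1 y1W] := other _ e1E xe1; have [y2 E2 y2W] := other _ e2E xe2.
  have [y1h|ne] := eqVneq y1 h; last by exists y1; rewrite /e -E1.
  exists y2; rewrite /e -E2; split=> //.
  by apply: contra e12 => /eqP y2h; rewrite E1 E2 y1h y2h.
have walk_path x p : path e x p -> {subset walk_edges x p <= E}.
  elim: p x => //= y p IH x /andP[xy /IH h] w; rewrite inE => /orP[/eqP->//|/h//].
suff ext k : (exists t, [/\ closed_walk t, 0 < size t.2, uniq (cedges t)
      & {subset cedges t <= E}]) \/
    exists x p, [/\ x \in W, path e x p, uniq (x :: p) & size p = k].
  case: (ext n) => // -[x [p [_ _ up sp]]].
  by have := max_card (mem (x :: p)); rewrite (card_uniqP up) card_ord /= sp ltnn.
elim: k => [|k [|[x [p [xW pp up sp]]]]]; [by right; exists x0, [::] | by left |].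
(* For the one-vertex path the default value [x] of [head] is harmless. Avoiding the head of [p]
   makes the closed cycle have at least three edges. *)
have [y [exy yh yW]] := nbr x (head x p) xW.
have [yp|yp] := boolP (y \in x :: p); last first.
  right; exists y, (x :: p); split=> //=; last by rewrite sp.
    by rewrite pp andbT /e setUC; exact: exy.
  by move: up yp => /= ->; rewrite andbT.
left; have yx : x != y := e_neq _ _ exy.
move: yp; rewrite inE eq_sym (negPf yx) /= => yp.
case/path.splitP: yp pp up yh {sp} => [[|h p1] p2]; first by rewrite /= eqxx.
rewrite rcons_cons => pp; rewrite -cat_cons cat_uniq => /andP[up _] /= yh.
move: pp; rewrite cat_path => /andP[pp _].
exists (y, x :: rcons (h :: p1) y); split=> //.
- rewrite /closed_walk /= last_rcons eqxx andbT eq_sym yx /=.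
  exact: (sub_path e_neq pp).
- rewrite /cedges /=.
  move: (uniq_walk_edges up) => /= /andP[-> ->]; rewrite !andbT inE negb_or.
  apply/andP; split; last first.
    apply: contra (proj1 (andP up)) => /mem_walk_edges; apply.
    by rewrite !inE eqxx orbT.
  apply/eqP=> /setP/(_ y); rewrite !inE eqxx /=.
  by rewrite eq_sym (negPf yx) (negPf yh).
- move=> w; rewrite /cedges [walk_edges _ _]/= inE => /orP[/eqP->|].
    by rewrite setUC.
  by apply: (walk_path x (rcons (h :: p1) y)).
Qed.

(** Deleting a vertex of degree at most one removes at most one edge and so preserves [#|W| < #|E|].
    When no such vertex is left, the minimum degree is two. *)
Lemma exists_cycle (W : {set 'I_n}) E :
  {in E, forall e : {set 'I_n}, #|e| = 2 /\ e \subset W} -> #|W| < #|E| ->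
  exists t, [/\ closed_walk t, 0 < size t.2, uniq (cedges t) & {subset cedges t <= E}].
Proof.
elim: {W}#|W| {-2}W (erefl #|W|) E => [|k IH] W cW E hE ltE.
  by move: ltE; rewrite cW => /card_gt0P[e /hE[c2 /subset_leq_card]]; rewrite c2 cW.
have /card_gt0P[x0 x0W] : 0 < #|W| by rewrite cW.
case: (pickP (fun v => (v \in W) && (#|[set e in E | v \in e]| <= 1))) => [v|high].
  case/andP=> vW dv; have cW' := cardsD1 v W; rewrite vW cW in cW'.
  case: (IH (W :\ v) _ (E :\: [set e in E | v \in e])).
  - by case: cW'.
  - move=> e; rewrite !inE => /andP[+ eE]; rewrite eE /= => ve.
    by have [-> /subsetP eW] := hE _ eE; split=> //; rewrite subsetD1 ve andbT; apply/subsetP.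
  - have := cardsID [set e in E | v \in e] E.
    have -> : E :&: [set e in E | v \in e] = [set e in E | v \in e].
      by apply/setP=> e; rewrite !inE andbA andbb.
    by move: ltE dv; lia.
  move=> t [h1 h2 h3 h4]; exists t; split=> // e /h4; rewrite inE => /andP[]//.
apply: (cycle_min_degree x0W hE) => v vW.
by have := high v; rewrite vW /= leqNgt => /negbFE.
Qed.

(** As long as more than [n] edges are present there is a cycle. Induction decomposes the graph
    without it, and the cycle is then merged into the family. *)
Lemma circuit_decomposition E : {in E, forall e : {set 'I_n}, #|e| = 2} ->
  exists s, [/\ circuit_family s, uniq (edges_of s), {subset edges_of s <= E}
    & #|E :\: [set e in edges_of s]| <= n].
Proof.
elim: {E}#|E| {-2}E (leqnn #|E|) => [|k IH] E cE hE.
  exists [::]; split=> //; rewrite (leq_trans (subset_leq_card (subsetDl _ _))) //.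
  exact: leq_trans cE _.
have [small|big] := leqP #|E| n.
  by exists [::]; split=> //; rewrite (leq_trans _ small) // subset_leq_card // subsetDl.
have [||[x [|y p]] [ct //]] := @exists_cycle setT E.
- by move=> e /hE ->; rewrite subsetT.
- by rewrite cardsT card_ord.
move=> _; set t := (x, y :: p) in ct * => ut st.
have et : [set x; y] \in cedges t by rewrite /cedges /= mem_head.
have [||s [fs us ss cs]] := IH (E :\: [set e in cedges t]).
- rewrite -ltnS (leq_trans _ cE) //; apply: proper_card.
  apply/properP; split; first exact: subsetDl.
  by exists [set x; y]; [exact: st|rewrite in_setD in_set et].
- by move=> e /setDP[/hE].
have [s' [fs' es' _]] := merge_circuit ct fs.
exists s'; split=> //.
- rewrite (perm_uniq es') cat_uniq ut us andbT /=.
  by apply/hasPn=> e /ss; rewrite !inE => /andP[].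
- move=> e; rewrite (perm_mem es') mem_cat => /orP[/st//|/ss].
  by rewrite inE => /andP[].
- apply: leq_trans cs; apply: subset_leq_card; apply/subsetP=> e.
  by rewrite !inE (perm_mem es') mem_cat negb_or => /andP[/andP[-> ->] ->].
Qed.

End Circuits.

(** * Circuits in 3-colourings *)

Lemma sum_card_pairs (V : finType) (P : rel V) :
  \sum_u #|[set v | P u v]| = #|[set uv : V * V | P uv.1 uv.2]|.
Proof.
rewrite -sum1_card; under [RHS]eq_bigl do rewrite inE.
rewrite -(pair_big_dep xpredT P (fun _ _ => 1)) /=; apply: eq_bigr => u _.
by rewrite -sum1_card; apply: eq_bigl => v; rewrite inE.
Qed.

(** An unordered pair arises only from its two orderings. *)
Lemma card_pairs_le (V : finType) (l : seq {set V}) :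
  #|[set uv : V * V | [set uv.1; uv.2] \in l]| <= 2 * size l.
Proof.
elim: l => [|e l IH]; first by rewrite eq_card0 // => uv; rewrite !inE.
rewrite /= mulnS; apply: (card_subU (A := [set uv : V * V | [set uv.1; uv.2] == e])) IH.
  by apply/subsetP=> uv; rewrite !inE.
case: (pickP (fun uv : V * V => [set uv.1; uv.2] == e)) => [[a b] /= /eqP eab|no]; last first.
  by rewrite eq_card0 // => uv; rewrite !inE no.
apply: leq_trans (_ : #|[set (a, b); (b, a)]| <= 2); last by rewrite cards2; case: (_ != _).
apply: subset_leq_card; apply/subsetP=> -[u v]; rewrite !inE !xpair_eqE /= -eab => /eqP/setP H.
have := H u; have := H v; have := H a; have := H b.
rewrite !inE !eqxx ?orbT /=.
by repeat (match goal with |- context [?x == ?y] => case: (@eqP _ x y) => ? //= end);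
  congruence.
Qed.

(** This applies [light_classes_absurd] with [Delta = n %/ Q], [Q = 2000 * q] and [d = n ^ 2 %/ q].
    At most [7 * Q] vertices lie outside [U], so [z] is at most a small multiple of [n / q] once [n]
    exceeds [1000 * Q ^ 2]. *)
Lemma large_class (q : nat) : 0 < q ->
  exists n0, forall (V T : finType) (D : 'I_3 -> rel V) (lab : 'I_3 -> V -> T),
    n0 <= #|V| ->
    (forall i u v, D i u v -> lab i u = lab i v) ->
    \sum_u #|[set v | ~~ [exists i, D i u v]]| <= 7 * #|V| ->
    exists i x, q * #|V| ^ 2 <= q * (6 * mass (D i) (lab i) (pred1 x)) + #|V| ^ 2.
Proof.
move=> q0; have [Q Qq] : exists Q, Q = 2000 * q by eexists.
exists (1000 * (Q * Q)) => V T D lab nV Dlab bad.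
set n := #|V| in nV bad *.
have n0 : 0 < n by nia.
case: (boolP [exists i, [exists x,
  q * n ^ 2 <= q * (6 * mass (D i) (lab i) (pred1 x)) + n ^ 2]]) => [|none].
  by case/existsP=> i /existsP[x h]; exists i, x.
exfalso.
pose U := [set u | #|[set v | ~~ [exists i, D i u v]]| <= n %/ Q].
(* Markov's inequality for the number of bad partners of a vertex. *)
have cU : #|~: U| * (n %/ Q).+1 <= 7 * n.
  apply: leq_trans bad; rewrite -sum_nat_const [X in _ <= X](bigID (mem (~: U))) /=.
  apply: leq_trans (leq_addr _ _); apply: leq_sum => u.
  by rewrite !inE -ltnNge.
have Q2000 : 2000 <= Q by rewrite Qq; lia.
have nlt : n < (n %/ Q).+1 * Q by rewrite ltn_ceil //; lia.
have nge : n %/ Q * Q <= n by rewrite leq_divM.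
apply: (@light_classes_absurd V T D lab (n %/ Q) (n ^ 2 %/ q)) => //;
  rewrite -/n -/U; [| |move=> i x].
- move: cU nlt nge; move: (n %/ Q) #|~: U| => k w h1 h2 h3.
  have h4 : k * 2000 <= n by apply: leq_trans h3; rewrite leq_mul2l Q2000 orbT.
  have h5 : 2000 * Q <= Q * Q by rewrite leq_mul2r Q2000 orbT.
  have h6 : w <= 7 * Q by rewrite leqNgt; apply/negP=> h; have := leq_mul h (leqnn k.+1); lia.
  lia.
- rewrite leq_divRL //.
  move: cU nlt nge; move: (n %/ Q) #|~: U| => k w h1 h2 h3.
  have h6 : w <= 7 * Q by rewrite leqNgt; apply/negP=> h; have := leq_mul h (leqnn k.+1); lia.
  have h7 : 2000 * (k * q) <= n by apply: leq_trans h3; rewrite Qq; lia.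
  have h8 : 2000 * (Q * q) = Q * Q by rewrite {3}Qq; lia.
  have h9 : w * q <= 7 * (Q * q) by rewrite mulnA leq_mul2r h6 orbT.
  have h5 : 2000 * Q <= Q * Q by rewrite leq_mul2r Q2000 orbT.
  (* The coefficient is [8 = 7 + 1]: the extra [n] absorbs the strict inequality. *)
  have h : (3 * (w + 6 * k) + 8) * q <= n.
    have -> : (3 * (w + 6 * k) + 8) * q = 3 * (w * q) + 18 * (k * q) + 8 * q by lia.
    move: Qq h9 h8 h7 nV h5.
    move: (w * q) (k * q) (Q * q) (Q * Q) => a b c e; lia.
  have := leq_mul h (leqnn n); rewrite -mulnn.
  have : q <= q * n by rewrite leq_pmulr.
  move: (w + 6 * k) => z.
  by rewrite !mulnDl mulSn; lia.
move: none; rewrite negb_exists => /forallP/(_ i); rewrite negb_exists => /forallP/(_ x).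
rewrite -ltnNge => h.
have h1 := leq_divM (n ^ 2) q; have h2 : n ^ 2 < (n ^ 2 %/ q).+1 * q by rewrite ltn_ceil.
move: h1 h2 h; move: (n ^ 2) (6 * _) => N m; move: (N %/ q) => d h1 h2 h.
have : (m + d) * q < N * q + q by lia.
by rewrite -mulSnr ltn_mul2r => /andP[_]; rewrite ltnS.
Qed.

(** * Labelling vertices by the circuit through them *)

Section Labels.
Variable n : nat.
Implicit Types (s : seq ('I_n * seq 'I_n)) (t : 'I_n * seq 'I_n).

(* Vertices on no circuit share the label [set0]; they lie on no edge of [s]. *)
Definition circuit_label s (v : 'I_n) : {set 'I_n} :=
  [set w | has (fun t => (v \in cverts t) && (w \in cverts t)) s].

Lemma vdisjoint_inj s t t' v : pairwise (@vdisjoint n) s -> t \in s -> t' \in s ->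
  v \in cverts t -> v \in cverts t' -> t = t'.
Proof.
move=> ds ts t's vt vt'.
elim: s ds ts t's => //= t0 s IH /andP[/allP d0 /IH {}IH].
rewrite !inE => /orP[/eqP tt|ts] /orP[/eqP t't|t's].
- by rewrite tt t't.
- by case/hasP: (d0 _ t's); exists v => //=; rewrite -tt.
- by case/hasP: (d0 _ ts); exists v => //=; rewrite -t't.
- exact: IH.
Qed.

Lemma circuit_labelE s t v : pairwise (@vdisjoint n) s -> t \in s -> v \in cverts t ->
  circuit_label s v = [set w in cverts t].
Proof.
move=> ds ts vt; apply/setP=> w; rewrite in_set [in RHS]in_set.
apply/hasP/idP => [[t' t's /andP[vt' wt']]|wt]; last by exists t; rewrite ?vt.
by rewrite (vdisjoint_inj ds ts t's vt vt').
Qed.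

Lemma cverts_edge t (u v : 'I_n) : [set u; v] \in cedges t ->
  (u \in cverts t) /\ (v \in cverts t).
Proof. by move=> /mem_walk_edges h; split; apply: h; rewrite !inE eqxx ?orbT. Qed.

Lemma edges_ofP s (e : {set 'I_n}) :
  reflect (exists2 t, t \in s & e \in cedges t) (e \in edges_of s).
Proof.
apply: (iffP flattenP) => [[_ /mapP[t ts ->] et]|[t ts et]]; first by exists t.
by exists (cedges t) => //; apply: map_f.
Qed.

Lemma circuit_label_edge s u v : circuit_family s -> [set u; v] \in edges_of s ->
  circuit_label s u = circuit_label s v.
Proof.
case/andP=> _ ds /edges_ofP[t ts /cverts_edge[ut vt]].
by rewrite !(circuit_labelE ds ts).
Qed.

(** By disjointness, a label taken on a circuit determines that circuit, which then carries every
    edge of [s] at a vertex with this label. *)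
Lemma mass_circuit s (x : {set 'I_n}) : 0 < n -> circuit_family s -> uniq (edges_of s) ->
  exists t, [/\ closed_walk t, uniq (cedges t), {subset cedges t <= edges_of s}
    & mass (fun u v => [set u; v] \in edges_of s) (circuit_label s) (pred1 x)
      <= 2 * size (cedges t)].
Proof.
move=> n0 /andP[cs ds] us.
pose P t := has (fun u => circuit_label s u == x) (cverts t).
case: (altP (@hasP _ P s)) => [[t ts /hasP[u0 u0t /eqP u0x]]|none].
  exists t; split; first exact: (allP cs).
  - case/path.splitPr: ts us => s1 s2.
    by rewrite /edges_of map_cat flatten_cat /= !cat_uniq => /and3P[_ _ /and3P[]].
  - by move=> e et; apply/edges_ofP; exists t.
  rewrite /mass big_mkcond /=.
  apply: leq_trans (card_pairs_le (cedges t)).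
  rewrite -(sum_card_pairs (fun u v => [set u; v] \in cedges t)).
  apply: leq_sum => u _; case: eqP => // ux.
  apply: subset_leq_card; apply/subsetP=> v; rewrite !inE => /edges_ofP[t' t's et'].
  have [ut' _] := cverts_edge et'.
  have := circuit_labelE ds t's ut'; rewrite ux -u0x (circuit_labelE ds ts u0t).
  move=> /setP/(_ u); rewrite in_set [in RHS]in_set ut' => ut.
  by rewrite (vdisjoint_inj ds ts t's ut ut').
(* No vertex on a circuit has label [x], so the mass is zero and a walk of length zero suffices. *)
exists (Ordinal n0, [::]); split => //.
rewrite /mass big1 // => u /eqP ux; apply/eqP; rewrite cards_eq0.
apply/eqP/setP=> v; rewrite !inE; apply/negP=> /edges_ofP[t ts /cverts_edge[ut _]].
case/negP: none; apply/hasP; exists t => //; apply/hasP; exists u => //.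
by rewrite ux.
Qed.

End Labels.

(** * From colourings to the asymptotic bound *)

Import Order.TTheory GRing.Theory Num.Theory.
Local Open Scope ring_scope.

Theorem mainTheorem4 (R : realType) (eps : R) (heps : 0 < eps) :
  exists n0 : nat, forall n : nat, (n0 <= n)%N ->
    forall c : coloring n 3,
      exists (x : 'I_n) (p : seq 'I_n),
        [/\ circuit x p, monochromatic c x p
          & (6%:R^-1 - eps) * ('C(n, 2))%:R <= (size p)%:R].
Proof.
pose q := (Num.bound eps^-1).+1.
have q0 : (0 < q)%N by [].
have qeps : q%:R^-1 <= eps.
  rewrite -[leRHS]invrK lef_pV2 ?posrE ?invr_gt0 ?ltr0n //.
  have := archi_boundP (ltW (etrans (invr_gt0 eps) heps)).
  by move=> /ltW /le_trans; apply; rewrite ler_nat.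
have [n0 large] := large_class q0.
exists (maxn n0 1) => n; rewrite geq_max => /andP[n0n npos] c.
pose E i := [set e : {set 'I_n} | [exists k : {e : {set 'I_n} | #|e| == 2%N},
  (val k == e) && (c k == i)]].
have E2 i : {in E i, forall e : {set 'I_n}, #|e| = 2%N}.
  by move=> e; rewrite inE => /existsP[k /andP[/eqP <- _]]; apply/eqP/(valP k).
have [f hf] : exists f : 'I_3 -> seq ('I_n * seq 'I_n), forall i,
    [/\ circuit_family (f i), uniq (edges_of (f i)), {subset edges_of (f i) <= E i}
      & (#|E i :\: [set e in edges_of (f i)]| <= n)%N].
  have [f0 h0] := circuit_decomposition (E2 ord0).
  have [f1 h1] := circuit_decomposition (E2 (@Ordinal 3 1 isT)).
  have [f2 h2] := circuit_decomposition (E2 (@Ordinal 3 2 isT)).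
  exists (fun i => nth [::] [:: f0; f1; f2] i).
  case=> -[|[|[|//]]] lt /=.
  + by rewrite (_ : Ordinal lt = ord0) //; apply: val_inj.
  + by rewrite (_ : Ordinal lt = @Ordinal 3 1 isT) //; apply: val_inj.
  + by rewrite (_ : Ordinal lt = @Ordinal 3 2 isT) //; apply: val_inj.
have [|i u v||i [x]] := large _ _ (fun i u v => [set u; v] \in edges_of (f i))
    (fun i => circuit_label (f i)).
- by rewrite card_ord.
- by have [fi _ _ _] := hf i; apply: circuit_label_edge.
(* The uncovered ordered pairs are the [n] diagonal ones and, in each of three colours, two for each
   of at most [n] leftover edges, hence [7 * n]. *)
- rewrite (sum_card_pairs (fun u v => ~~ [exists i, [set u; v] \in edges_of (f i)])).
  pose B i := [set uv : 'I_n * 'I_n |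
    [set uv.1; uv.2] \in enum (E i :\: [set e in edges_of (f i)])].
  have cB i : (#|B i| <= 2 * n)%N.
    apply: leq_trans (card_pairs_le _) _.
    by rewrite -cardE leq_mul2l /=; have [_ _ _] := hf i.
  have cdiag : (#|[set (u, u) | u : 'I_n]| <= n)%N.
    by rewrite (leq_trans (leq_imset_card _ _)) // card_ord.
  rewrite card_ord (_ : 7 * n = n + (2 * n + (2 * n + 2 * n)))%N; last by lia.
  apply: (card_subU _ cdiag (card_subU (subxx _) (cB ord0) (card_subU (subxx _)
    (cB (@Ordinal 3 1 isT)) (cB (@Ordinal 3 2 isT))))).
  apply/subsetP=> -[u v]; rewrite inE /= => /existsPn none.
  have [->|uv] := eqVneq u v; first by rewrite inE imset_f.
  have cuv : #|[set u; v]| == 2%N by rewrite cards2 uv.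
  pose k : {e : {set 'I_n} | #|e| == 2%N} := Sub [set u; v] cuv.
  have : (u, v) \in B (c k).
    rewrite inE mem_enum in_setD [X in ~~ X]in_set none /= inE.
    by apply/existsP; exists k; rewrite SubK !eqxx.
  case: (c _) => -[|[|[|//]]] lt.
  + by rewrite (_ : Ordinal lt = ord0) ?in_setU => [->|]; [rewrite ?orbT|apply: val_inj].
  + rewrite (_ : Ordinal lt = @Ordinal 3 1 isT); last exact: val_inj.
    by rewrite !in_setU => ->; rewrite ?orbT.
  + rewrite (_ : Ordinal lt = @Ordinal 3 2 isT); last exact: val_inj.
    by rewrite !in_setU => ->; rewrite ?orbT.
have [fi ui si _] := hf i.
have [[y p] [/andP[/= wp /eqP lp] up sp mp]] := mass_circuit x npos fi ui.
rewrite card_ord => big; exists y, p; split.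
- by rewrite /circuit /trail wp lp up eqxx.
- exists i => e /sp /si; rewrite inE => /existsP[k /andP[/eqP ke /eqP <-]].
  by congr (c _); apply: val_inj.
have size_edges : size (cedges (y, p)) = size p by rewrite /cedges /walk_edges size_pairmap.
(* The constant is [12 = 6 * 2], as the mass is at most twice the length. *)
have {}big : (q * n ^ 2 <= 12 * (q * size p) + n ^ 2)%N.
  apply: leq_trans big _; rewrite leq_add2r mulnCA; move: mp; rewrite size_edges.
  by move: (mass _ _ _) => m; nia.
have bin : ('C(n, 2) * 2 <= n ^ 2)%N.
  by rewrite bin2 muln2 -mulnn; have := odd_double_half (n * n.-1); nia.
(* A positive factor is needed to multiply the estimate ['C(n, 2) * 2 <= n ^ 2]; otherwise the bound
   is trivial. *)
have [neg|pos] := leP (6%:R^-1 - eps) 0.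
  by apply: le_trans (_ : 0 <= _); rewrite ?ler0n // mulr_le0_ge0.
have {}bin : ('C(n, 2))%:R * 2 <= (n ^ 2)%:R :> R by rewrite -natrM ler_nat.
have {}big : q%:R * (n ^ 2)%:R <= 12 * (q%:R * (size p)%:R) + (n ^ 2)%:R :> R.
  by rewrite -!natrM -natrD ler_nat.
have qpos : 0 < q%:R :> R by rewrite ltr0n.
have qi : q%:R^-1 * q%:R = 1 :> R by rewrite mulVf ?gt_eqF.
have : (n ^ 2)%:R * (1 - q%:R^-1) <= 12 * (size p)%:R :> R.
  rewrite -(ler_pM2l qpos) mulrCA mulrBr mulr1 [q%:R * _^-1]mulrC qi.
  lra.
have : (6%:R^-1 - eps) * ('C(n, 2)%:R * 2) <= (6%:R^-1 - eps) * (n ^ 2)%:R.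
  by rewrite ler_pM2l.
have : (n ^ 2)%:R * q%:R^-1 <= (n ^ 2)%:R * eps by rewrite ler_wpM2l.
have := ler0n R (n ^ 2).
have : 0 <= (n ^ 2)%:R * eps by rewrite mulr_ge0 // ltW.
rewrite !mulrBl !mulrBr mulr1.
move: (_%:R) (_%:R) => a b; lra.
Qed.
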